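(* Assume the reduced operator $\widehat A_h\in\mathbb{R}^{n_h\times n_h}$ is square and invertible. For every query $x_i$ and every linear projector $\Pi_{i,R}:\mathbb{R}^{M_h}\to\mathbb{R}^{M_h}$, $\Pi_{i,R}^2=\Pi_{i,R}$, $$\ell_{i,h}^\top(U_\theta-U_h^\star)=\bigl(g_{i,h}^{\mathrm{loc}}(R)\bigr)^\top r_h^{\mathrm{loc}}(R)+\bigl(g_{i,h}^{\mathrm{tail}}(R)\bigr)^\top r_h^{\mathrm{tail}}(R).$$ Consequently, $$|\ell_{i,h}^\top(U_\theta-U_h^\star)|\le\left|\bigl(g_{i,h}^{\mathrm{loc}}(R)\bigr)^\top r_h^{\mathrm{loc}}(R)\right|+\|g_{i,h}^{\mathrm{tail}}(R)\|_{W_h^{-1}}\|r_h^{\mathrm{tail}}(R)\|_{W_h},$$ and a pure norm split gives $$|\ell_{i,h}^\top(U_\theta-U_h^\star)|\le\|g_{i,h}^{\mathrm{loc}}(R)\|_{W_h^{-1}}\|r_h^{\mathrm{loc}}(R)\|_{W_h}+\|g_{i,h}^{\mathrm{tail}}(R)\|_{W_h^{-1}}\|r_h^{\mathrm{tail}}(R)\|_{W_h}.$$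
   Context: Let $U_{0,h}\in\mathbb{R}^{N_h}$ and let $Z_h\in\mathbb{R}^{N_h\times n_h}$ have full column rank. Let $A_h\in\mathbb{R}^{M_h\times N_h}$, $b_h\in\mathbb{R}^{M_h}$, $\widehat A_h:=A_hZ_h$, $\widehat b_h:=b_h-A_hU_{0,h}$. In the square setting $M_h=n_h$. Let $W_h\in\mathbb{R}^{M_h\times M_h}$ be symmetric positive definite, $\|r\|_{W_h}:=(r^\top W_hr)^{1/2}$, $\|g\|_{W_h^{-1}}:=(g^\top W_h^{-1}g)^{1/2}$, $\widehat H_h:=\widehat A_h^\top W_h\widehat A_h$. The discrete target is $U_h^\star:=U_{0,h}+Z_h\widehat A_h^{-1}\widehat b_h$. $U_\theta=U_{0,h}+Z_hy_\theta$ is an arbitrary admissible vector with residual $r_h:=A_hU_\theta-b_h$. To the query $x_i$ is attached a query vector $\ell_{i,h}\in\mathbb{R}^{N_h}$; $q_{i,h}$ solves $\widehat H_hq_{i,h}=Z_h^\top\ell_{i,h}$ and $g_{i,h}:=W_h\widehat A_hq_{i,h}$. For a radius parameter $R$ and a projector $\Pi_{i,R}$ (not necessarily orthogonal), define $g_{i,h}^{\mathrm{loc}}(R):=\Pi_{i,R}^\top g_{i,h}$, $g_{i,h}^{\mathrm{tail}}(R):=(I-\Pi_{i,R})^\top g_{i,h}$, $r_h^{\mathrm{loc}}(R):=\Pi_{i,R}r_h$, $r_h^{\mathrm{tail}}(R):=(I-\Pi_{i,R})r_h$. *)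

(* Defs.v *)
From mathcomp Require Import all_boot all_order all_algebra.
From mathcomp Require Import reals.

Set Implicit Arguments.
Unset Strict Implicit.
Unset Printing Implicit Defensive.

Import Order.TTheory GRing.Theory Num.Theory.
Local Open Scope ring_scope.

(* [u^T *m v] is a 1 x 1 matrix; its unique entry is the scalar u^T v. *)
Definition dotcv (R : realType) (n : nat) (u v : 'cV[R]_n) : R :=
  (u^T *m v) 0 0.

Definition sympd (R : realType) (n : nat) (W : 'M[R]_n) : Prop :=
  W^T = W /\ (forall v : 'cV[R]_n, v != 0 -> 0 < dotcv v (W *m v)).

(* The W^-1-norm is [wnorm (invmx W)]; a positive definite W is invertible, so
   [invmx W] is then its true inverse. *)
Definition wnorm (R : realType) (n : nat) (W : 'M[R]_n) (v : 'cV[R]_n) : R :=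
  Num.sqrt (dotcv v (W *m v)).

(* Not necessarily orthogonal: no relation to W or to the transpose. *)
Definition projector (R : realType) (n : nat) (P : 'M[R]_n) : Prop :=
  P *m P = P.

(* Main.v *)
(* With e = y - Ahat^-1 bhat one has U - U* = Z e and r = Ahat e, so the
   equation for q turns l^T (U - U* ) into g^T r.  Idempotence of P and of I - P
   then splits g^T r without cross terms, and each term is bounded by
   Cauchy-Schwarz in the W-inner product. *)
Require Import Defs.
From mathcomp Require Import all_boot all_order all_algebra.
From mathcomp Require Import reals.
From mathcomp Require Import ring.

Set Implicit Arguments.
Unset Strict Implicit.
Unset Printing Implicit Defensive.

Import Order.TTheory GRing.Theory Num.Theory.
Local Open Scope ring_scope.

Lemma dotcvC (R : realType) (n : nat) (u v : 'cV[R]_n) : dotcv u v = dotcv v u.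
Proof. by rewrite /dotcv !mxE; apply: eq_bigr => k _; rewrite !mxE mulrC. Qed.

Lemma dotcvDr (R : realType) (n : nat) (u v w : 'cV[R]_n) :
  dotcv u (v + w) = dotcv u v + dotcv u w.
Proof. by rewrite /dotcv mulmxDr mxE. Qed.

Lemma dotcvZr (R : realType) (n : nat) (a : R) (u v : 'cV[R]_n) :
  dotcv u (a *: v) = a * dotcv u v.
Proof. by rewrite /dotcv -scalemxAr mxE. Qed.

Lemma dotcvDl (R : realType) (n : nat) (u v w : 'cV[R]_n) :
  dotcv (u + v) w = dotcv u w + dotcv v w.
Proof. by rewrite dotcvC dotcvDr !(dotcvC w). Qed.

Lemma dotcvZl (R : realType) (n : nat) (a : R) (u v : 'cV[R]_n) :
  dotcv (a *: u) v = a * dotcv u v.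
Proof. by rewrite dotcvC dotcvZr dotcvC. Qed.

Lemma dotcv_adj (R : realType) (m n : nat) (M : 'M[R]_(m, n)) (u : 'cV[R]_n)
    (v : 'cV[R]_m) : dotcv (M *m u) v = dotcv u (M^T *m v).
Proof. by rewrite /dotcv trmx_mul mulmxA. Qed.

Lemma sympd_ge0 (R : realType) (n : nat) (W : 'M[R]_n) (v : 'cV[R]_n) :
  sympd W -> 0 <= dotcv v (W *m v).
Proof.
case=> _ Wpos; have [->|v0] := eqVneq v 0; last exact/ltW/Wpos.
by rewrite /dotcv mulmx0 mulmx0 mxE.
Qed.

(** A row vector [v] in the left kernel satisfies [v *m W *m v^T = 0], which definiteness allows
    only for [v = 0]. *)
Lemma sympd_unitmx (R : realType) (n : nat) (W : 'M[R]_n) :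
  sympd W -> W \in unitmx.
Proof.
case=> Wsym Wpos; rewrite -row_free_unit -kermx_eq0.
apply/rowV0P => v /sub_kermxP vW.
apply/eqP/negPn/negP => v0; have := Wpos v^T; rewrite trmx_eq0 => /(_ v0).
by rewrite /dotcv trmxK mulmxA vW mul0mx mxE ltxx.
Qed.

(** The quadratic form is nonnegative at [a *: u - c *: v], the W-orthogonal projection residual of
    [u] along [v] scaled by [a] to avoid division. *)
Lemma sympd_cauchy_schwarz (R : realType) (n : nat) (W : 'M[R]_n)
    (u v : 'cV[R]_n) :
  sympd W -> dotcv u (W *m v) ^+ 2 <= dotcv u (W *m u) * dotcv v (W *m v).
Proof.
move=> Wpd; have [->|v0] := eqVneq v 0.
  by rewrite /dotcv !mulmx0 !mxE expr0n mulr0.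
set a := dotcv v (W *m v); set c := dotcv u (W *m v).
have a_gt0 : 0 < a by case: Wpd => _; apply.
have vWu : dotcv v (W *m u) = c by rewrite dotcvC dotcv_adj Wpd.1.
have := sympd_ge0 (a *: u + (- c) *: v) Wpd.
rewrite mulmxDr -!scalemxAr !(dotcvDl, dotcvDr, dotcvZl, dotcvZr) vWu -/a -/c.
set d := dotcv u (W *m u).
(* The two cross terms give [- 2 a c^2] and the last square gives [a c^2]; the factor [a > 0] then
   cancels. *)
by rewrite (_ : _ + _ = a * (d * a - c ^+ 2)) ?pmulr_rge0 ?subr_ge0//; ring.
Qed.

(* Cauchy-Schwarz in the W-inner product, applied to [W^-1 g] and [r]. *)
Lemma dotcv_le_wnorm (R : realType) (n : nat) (W : 'M[R]_n) (g r : 'cV[R]_n) :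
  sympd W -> `|dotcv g r| <= wnorm (invmx W) g * wnorm W r.
Proof.
move=> Wpd; have Wu := sympd_unitmx Wpd.
have gE : g = W *m (invmx W *m g) by rewrite mulKVmx.
set w := invmx W *m g in gE.
have -> : dotcv g r = dotcv w (W *m r) by rewrite gE dotcv_adj Wpd.1.
(* The dual norm of [g] is thus the W-norm of [w]. *)
have wgE : dotcv g w = dotcv w (W *m w) by rewrite dotcvC -gE.
rewrite /wnorm -/w wgE -sqrtrM ?sympd_ge0// -sqrtr_sqr.
exact/ler_wsqrtr/sympd_cauchy_schwarz.
Qed.

(** Moving [P^T] across the pairing produces [P *m P]. With the projector gone from the dual factor,
    the local and tail pairings become additive in the residual. *)
Lemma dotcv_projector (R : realType) (n : nat) (P : 'M[R]_n) (g r : 'cV[R]_n) :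
  projector P -> dotcv (P^T *m g) (P *m r) = dotcv g (P *m r).
Proof. by move=> PP; rewrite dotcv_adj trmxK mulmxA PP. Qed.

Lemma projector_compl (R : realType) (n : nat) (P : 'M[R]_n) :
  projector P -> projector (1%:M - P).
Proof.
by move=> PP; rewrite /projector mulmxBl mul1mx mulmxBr mulmx1 PP subrr subr0.
Qed.

Theorem proposition5p7 (R : realType) (N n : nat)
    (U0 : 'cV[R]_N) (Z : 'M[R]_(N, n)) (A : 'M[R]_(n, N)) (b : 'cV[R]_n)
    (W : 'M[R]_n) (Query : Type) (ell : Query -> 'cV[R]_N)
    (q : Query -> 'cV[R]_n) (y : 'cV[R]_n) :
  let Ahat : 'M[R]_n := A *m Z in
  let bhat : 'cV[R]_n := b - A *m U0 in
  let Hhat : 'M[R]_n := Ahat^T *m W *m Ahat in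
  let Ustar : 'cV[R]_N := U0 + Z *m (invmx Ahat *m bhat) in
  let U : 'cV[R]_N := U0 + Z *m y in
  let r : 'cV[R]_n := A *m U - b in
  let g : Query -> 'cV[R]_n := fun i => W *m Ahat *m q i in
  \rank Z = n ->
  sympd W ->
  (forall i : Query, Hhat *m q i = Z^T *m ell i) ->
  Ahat \in unitmx ->
  forall (i : Query) (P : 'M[R]_n), projector P ->
  let gloc : 'cV[R]_n := P^T *m g i in
  let gtail : 'cV[R]_n := (1%:M - P)^T *m g i in
  let rloc : 'cV[R]_n := P *m r in
  let rtail : 'cV[R]_n := (1%:M - P) *m r in
  [/\ dotcv (ell i) (U - Ustar) = dotcv gloc rloc + dotcv gtail rtail,
      `|dotcv (ell i) (U - Ustar)|
        <= `|dotcv gloc rloc| + wnorm (invmx W) gtail * wnorm W rtail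
    & `|dotcv (ell i) (U - Ustar)|
        <= wnorm (invmx W) gloc * wnorm W rloc
           + wnorm (invmx W) gtail * wnorm W rtail].
Proof.
move=> Ahat bhat Hhat Ustar U r g _ Wpd Hq Aunit i P PP gloc gtail rloc rtail.
set e := y - invmx Ahat *m bhat.
have errE : U - Ustar = Z *m e by rewrite opprD addrACA subrr add0r -mulmxBr.
have resE : r = Ahat *m e.
  (* Invertibility of [Ahat] reduces [Ahat *m e] to [Ahat *m y - bhat]. *)
  rewrite mulmxBr mulKVmx// /r /U /bhat mulmxDr mulmxA -/Ahat opprB.
  by rewrite [A *m U0 + _]addrC addrA.
have pairing : dotcv (ell i) (U - Ustar) = dotcv (g i) r.
  (* The defining equation of [q] replaces [Z^T *m ell i], and the outer [Ahat^T] of [Hhat] moves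
     onto [e]. Abstracting [Ahat] as [B] keeps it one factor during reassociation. *)
  rewrite errE dotcvC dotcv_adj -Hq dotcvC resE /g /Hhat; move: (Ahat) => B.
  by rewrite -!mulmxA dotcv_adj trmxK.
have split : dotcv (ell i) (U - Ustar) = dotcv gloc rloc + dotcv gtail rtail.
  rewrite pairing !dotcv_projector//; last exact: projector_compl.
  by rewrite -dotcvDr -mulmxDl addrC subrK mul1mx.
have mixed : `|dotcv (ell i) (U - Ustar)|
    <= `|dotcv gloc rloc| + wnorm (invmx W) gtail * wnorm W rtail.
  (* Only the tail pairing is estimated by norms here; cancellation inside the local one is kept. *)
  by rewrite split (le_trans (ler_normD _ _))// lerD2l dotcv_le_wnorm.
split=> //; apply: (le_trans mixed).
by rewrite lerD2r dotcv_le_wnorm.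
Qed.
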